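(* Let $(H,g)$ be an Engel sub-Lorentzian structure of Hamiltonian type on a neighbourhood of $0\in\mathbb R^4$ (coordinates $x,y,z,w$) given by an orthonormal frame in the normal form $$X=\frac{\partial}{\partial x}+y\varphi\left(y\frac{\partial}{\partial x}+x\frac{\partial}{\partial y}\right)+\frac12 y(1+\psi_1)\frac{\partial}{\partial z}+\frac12 y^2(1+\psi_2)\frac{\partial}{\partial w},$$ $$Y=\frac{\partial}{\partial y}-x\varphi\left(y\frac{\partial}{\partial x}+x\frac{\partial}{\partial y}\right)-\frac12 x(1+\psi_1)\frac{\partial}{\partial z}-\frac12 xy(1+\psi_2)\frac{\partial}{\partial w},$$ with $X$ a time orientation, where $\varphi,\psi_1,\psi_2$ are smooth, $\psi_1(0,0,z,w)=0$, $\psi_2(0,0,0,w)=0$, and where $\varphi=\varphi(x,y,w)$ and $\psi_2=\psi_2(x,y,w)$ do not depend on $z$. Then for every sufficiently small normal neighbourhood $U$ of $0$, the abnormal curve starting from $0$, i.e. the timelike future directed curve $\gamma(t)=(t,0,0,0)$, $t\in[0,T]$, with $\gamma([0,T])\subset U$, is geometrically optimal: $\gamma([0,T])\subset\partial_U J^+(0,U)$.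
   Context: A sub-Lorentzian structure on a manifold $M$ is a pair $(H,g)$ with $H$ a smooth bracket generating distribution of constant rank and $g$ a smooth Lorentzian metric (signature $(-,+,\dots,+)$) on $H$. A vector $v\in H_q$ is timelike if $g(v,v)<0$, nonspacelike if $g(v,v)\le 0$ and $v\ne0$, null if $g(v,v)=0$ and $v\neq 0$. A time orientation is a continuous timelike field $X$ (a section of $H$); a nonspacelike $v\in H_q$ is future directed if $g(v,X(q))<0$. A curve is horizontal if it is absolutely continuous and $\dot\gamma(t)\in H_{\gamma(t)}$ a.e.; all curves are horizontal, and a curve is timelike/nonspacelike/null future directed if $\dot\gamma(t)$ is so a.e. An orthonormal frame $X,Y$ satisfies $g(X,X)=-1$, $g(Y,Y)=1$, $g(X,Y)=0$. A Hamiltonian geodesic is a horizontal curve that is the projection to $M$ of an integral curve of the Hamiltonian vector field on $T^*M$ of $\mathcal H(q,p)=-\frac12\langle p,X(q)\rangle^2+\frac12\langle p,Y(q)\rangle^2$. With $H^\perp\subset T^*M$ the annihilator of $H$ and $\Omega$ the restriction to $H^\perp$ of the canonical symplectic form, an abnormal biextremal is an absolutely continuous curve $\lambda$ in $H^\perp$, never meeting the zero section, with $\Omega_{\lambda(t)}(\dot\lambda(t),\zeta)=0$ for a.e. $t$ and all $\zeta\in T_{\lambda(t)}H^\perp$; a horizontal curve is abnormal if it is the projection of an abnormal biextremal. Let $H^i_q$ be the span at $q$ of iterated Lie brackets of length $\le i$ of sections of $H$. A rank $2$ distribution on a $4$-manifold is Engel if $H^2$ has constant rank $3$ and $H^3$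 constant rank $4$; exactly one unparameterized abnormal curve then passes through each point. $(H,g)$ is an Engel sub-Lorentzian structure of Hamiltonian type if $H$ is Engel and its abnormal curves are, possibly after reparameterization, timelike future directed Hamiltonian geodesics. For a neighbourhood $U$ of $q_0$, $J^+(q_0,U)$ is the set of all points of $U$ that can be reached from $q_0$ by a nonspacelike future directed curve contained in $U$. $\partial_U$ denotes the boundary relative to $U$. A nonspacelike future directed curve $\gamma:[0,T]\to U$ is geometrically optimal if $\gamma([0,T])\subset\partial_UJ^+(\gamma(0),U)$. $U$ is a normal neighbourhood of $q_0$ if, for some extension of $g$ to a Lorentzian metric $\hat g$ (on the full tangent bundle) near $U$, $U$ is a convex normal neighbourhood of $q_0$ with respect to $\hat g$ and its closure is contained in another convex normal neighbourhood of $q_0$ with respect to $\hat g$. *)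

(* Defs.v *)
From HB Require Import structures.
From mathcomp Require Import all_boot all_order all_algebra.
From mathcomp Require Import all_classical all_reals all_analysis.

Set Implicit Arguments.
Unset Strict Implicit.
Unset Printing Implicit Defensive.

Import Order.TTheory GRing.Theory Num.Theory.
Import numFieldNormedType.Exports.

Local Open Scope classical_set_scope.
Local Open Scope ring_scope.

(* The manifold is an open subset M of R^n, its tangent and cotangent spaces
   are identified with 'rV[R]_n, so that T^*M is a part of
   'rV[R]_n * 'rV[R]_n (base point first).  Functions are total; only their
   values on M, resp. on the interval of definition of a curve, matter. *)

Section calculus.
Context {R : realType}.

(* For finite-dimensional V and open D, a map is C^k on D iff its iterated
   derivatives of order at most k in constant directions exist and are
   continuous on D. *)
Fixpoint Ck_on {V W : normedModType R} (k : nat) (D : set V) (f : V -> W)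
    : Prop :=
  (forall q, D q -> {for q, continuous f}) /\
  match k with
  | 0 => True
  | k'.+1 => forall v : V,
      (forall q, D q -> derivable f q v) /\ Ck_on k' D (fun q => 'D_v f q)
  end.

Definition smooth_on {V W : normedModType R} (D : set V) (f : V -> W) :=
  forall k, Ck_on k D f.

Definition abs_continuous {W : normedModType R} (a b : R) (f : R -> W) :=
  forall e : R, 0 < e -> exists2 d : R, 0 < d &
    forall (m : nat) (u v : 'I_m -> R),
      (forall i, a <= u i /\ u i <= v i /\ v i <= b) ->
      (forall i j, i != j -> v i <= u j \/ v j <= u i) ->
      \sum_(i < m) (v i - u i) < d ->
      \sum_(i < m) `|f (v i) - f (u i)| < e.

Definition ae_on (a b : R) (P : R -> Prop) :=
  {ae (@lebesgue_measure R), forall t, t \in `[a, b] -> P t}.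

Definition rel_boundary {T : topologicalType} (U A : set T) : set T :=
  U `&` closure (A `&` U) `&` closure (U `\` A).

End calculus.

Section distributions.
Context {R : realType} {n : nat}.
Local Notation vec := 'rV[R]_n.
Implicit Types (M : set vec) (H : vec -> {vspace vec}).

Definition section_on H (W : set vec) (A : vec -> vec) :=
  smooth_on W A /\ forall q, W q -> A q \in H q.

Definition smooth_distribution M H (r : nat) :=
  forall q, M q -> exists W : set vec, [/\ open W, W q, W `<=` M &
    exists A : 'I_r -> vec -> vec,
      (forall i, smooth_on W (A i)) /\
      (forall q', W q' ->
         basis_of (H q') [seq A i q' | i <- enum 'I_r])].

Definition lie_bracket (A B : vec -> vec) : vec -> vec :=
  fun q => 'D_(A q) B q - 'D_(B q) A q.

Inductive iterated_bracket H (W : set vec) : nat -> (vec -> vec) -> Prop :=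
| iterated_bracket_section A :
    section_on H W A -> iterated_bracket H W 1 A
| iterated_bracket_bracket i j A B :
    iterated_bracket H W i A -> iterated_bracket H W j B ->
    iterated_bracket H W (i + j) (lie_bracket A B).

(* V = H^i_q, the sections being local sections near q. *)
Definition is_flag M H (i : nat) (q : vec) (V : {vspace vec}) :=
  let brackets := [set v | exists (W : set vec) j A,
    [/\ open W, W q, W `<=` M & (j <= i)%N] /\
    iterated_bracket H W j A /\ v = A q] in
  (forall v, brackets v -> v \in V) /\
  (forall V' : {vspace vec},
     (forall v, brackets v -> v \in V') -> (V <= V')%VS).

Definition bracket_generating M H :=
  forall q, M q -> exists i, is_flag M H i q fullv.

Definition flag_rank M H (i r : nat) :=
  forall q, M q -> exists2 V : {vspace vec}, is_flag M H i q V & \dim V = r.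

End distributions.

Section sub_lorentzian.
Context {R : realType} {n : nat}.
Local Notation vec := 'rV[R]_n.
Implicit Types (M : set vec) (H : vec -> {vspace vec}).
Implicit Types (g : vec -> vec -> vec -> R) (X Y : vec -> vec).

(* Only the values g q v w with v, w in H q are meaningful. *)
Definition lorentzian_metric M H g :=
  [/\ forall q, M q -> forall (a : R) u v w,
        u \in H q -> v \in H q -> w \in H q ->
        g q (a *: u + v) w = a * g q u w + g q v w,
      forall q, M q -> forall v w, v \in H q -> w \in H q ->
        g q v w = g q w v,
      forall q, M q -> exists m (e : m.+1.-tuple vec),
        basis_of (H q) e /\
        forall i j : 'I_m.+1, g q (tnth e i) (tnth e j) =
          if i != j then 0 else if i == ord0 then -1 else 1 &
      forall (W : set vec) A B, open W -> W `<=` M ->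
        section_on H W A -> section_on H W B ->
        smooth_on W (fun q => g q (A q) (B q))].

Definition sub_lorentzian M H g :=
  [/\ exists r, smooth_distribution M H r, bracket_generating M H &
      lorentzian_metric M H g].

Definition timelike H g (q v : vec) := v \in H q /\ g q v v < 0.

Definition nonspacelike H g (q v : vec) :=
  [/\ v \in H q, g q v v <= 0 & v != 0].

Definition time_orientation M H g X :=
  forall q, M q -> {for q, continuous X} /\ timelike H g q (X q).

(* Meaningful for nonspacelike v, X being the time orientation. *)
Definition future_directed g X (q v : vec) := g q v (X q) < 0.

Definition orthonormal_frame M H g X Y :=
  [/\ smooth_on M X, smooth_on M Y &
      forall q, M q ->
        [/\ H q = <<[:: X q; Y q]>>%VS,
            g q (X q) (X q) = -1, g q (Y q) (Y q) = 1 & g q (X q) (Y q) = 0]].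

Definition horizontal M H (a b : R) (c : R -> vec) :=
  [/\ forall t, t \in `[a, b] -> M (c t), abs_continuous a b c &
      ae_on a b (fun t => derivable c t 1 /\ derive1 c t \in H (c t))].

Definition timelike_fd_curve M H g X (a b : R) (c : R -> vec) :=
  horizontal M H a b c /\
  ae_on a b (fun t => timelike H g (c t) (derive1 c t) /\
                      future_directed g X (c t) (derive1 c t)).

Definition nonspacelike_fd_curve M H g X (a b : R) (c : R -> vec) :=
  horizontal M H a b c /\
  ae_on a b (fun t => nonspacelike H g (c t) (derive1 c t) /\
                      future_directed g X (c t) (derive1 c t)).

(* J^+(q0, U); T = 0 is allowed, so that q0 itself is reached. *)
Definition causal_future M H g X (q0 : vec) (U : set vec) : set vec :=
  [set q | exists (T : R) (c : R -> vec),
     [/\ 0 <= T, nonspacelike_fd_curve M H g X 0 T c,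
         forall t, t \in `[0, T] -> U (c t), c 0 = q0 & c T = q]].

Definition geometrically_optimal M H g X (U : set vec) (T : R)
    (c : R -> vec) :=
  [/\ nonspacelike_fd_curve M H g X 0 T c,
      forall t, t \in `[0, T] -> U (c t) &
      forall t, t \in `[0, T] ->
        rel_boundary U (causal_future M H g X (c 0) U) (c t)].

End sub_lorentzian.

Section cotangent.
Context {R : realType} {n : nat}.
Local Notation vec := 'rV[R]_n.
Local Notation cot := ('rV[R]_n * 'rV[R]_n)%type.
Implicit Types (M : set vec) (H : vec -> {vspace vec}).
Implicit Types (g : vec -> vec -> vec -> R) (X Y : vec -> vec).

Definition pairing (p v : vec) : R := \sum_i p ord0 i * v ord0 i.

Definition hamiltonian X Y (l : cot) : R :=
  - (pairing l.2 (X l.1) ^+ 2 / 2) + pairing l.2 (Y l.1) ^+ 2 / 2.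

Definition hamiltonian_field (h : cot -> R) (l : cot) : cot :=
  (\row_i 'D_((0, delta_mx ord0 i) : cot) h l,
   - \row_i 'D_((delta_mx ord0 i, 0) : cot) h l).

Definition integral_curve (F : cot -> cot) (a b : R) (l : R -> cot) :=
  {within `[a, b], continuous l} /\
  forall t, t \in `]a, b[ -> is_derive t (1 : R) l (F (l t)).

(* The Hamiltonian does not depend on the orthonormal frame X, Y. *)
Definition hamiltonian_geodesic M H X Y (a b : R) (c : R -> vec) :=
  horizontal M H a b c /\
  exists l : R -> cot,
    integral_curve (hamiltonian_field (hamiltonian X Y)) a b l /\
    forall t, t \in `[a, b] -> (l t).1 = c t.

Definition annihilator M H : set cot :=
  [set l | M l.1 /\ forall v, v \in H l.1 -> pairing l.2 v = 0].

(* zeta is tangent at l to the submanifold S. *)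
Definition tangent_at (S : set cot) (l zeta : cot) :=
  exists (e : R) (c : R -> cot),
    [/\ 0 < e, smooth_on `]- e, e[ c & forall s, s \in `]- e, e[ -> S (c s)]
    /\ c 0 = l /\ derive1 c 0 = zeta.

Definition symplectic_form (u v : cot) : R :=
  pairing u.2 v.1 - pairing v.2 u.1.

Definition abnormal_biextremal M H (a b : R) (l : R -> cot) :=
  [/\ abs_continuous a b l,
      forall t, t \in `[a, b] -> annihilator M H (l t) /\ (l t).2 != 0 &
      ae_on a b (fun t => derivable l t 1 /\
        forall zeta, tangent_at (annihilator M H) (l t) zeta ->
          symplectic_form (derive1 l t) zeta = 0)].

Definition abnormal_curve M H (a b : R) (c : R -> vec) :=
  horizontal M H a b c /\
  exists l : R -> cot, abnormal_biextremal M H a b l /\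
    forall t, t \in `[a, b] -> (l t).1 = c t.

(* c1 on [a1, b1] is a reparameterization, possibly orientation reversing, of
   c2 on [a2, b2]. *)
Definition reparameterization (a1 b1 : R) (c1 : R -> vec)
    (a2 b2 : R) (c2 : R -> vec) :=
  exists s : R -> R, [/\ {within `[a1, b1], continuous s},
    set_bij `[a1, b1] `[a2, b2] s &
    forall t, t \in `[a1, b1] -> c1 t = c2 (s t)].

End cotangent.

Section engel.
Context {R : realType}.
Local Notation vec := 'rV[R]_4.
Implicit Types (M : set vec) (H : vec -> {vspace vec}).
Implicit Types (g : vec -> vec -> vec -> R) (X Y : vec -> vec).

Definition engel M H :=
  [/\ smooth_distribution M H 2, flag_rank M H 2 3 & flag_rank M H 3 4].

(* The condition bears on abnormal curves up to reparameterization: only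
   injective ones are considered, as a parameterized abnormal curve may also
   be constant, stop, or go back and forth along the leaf.  X, Y is an
   orthonormal frame and Z a time orientation. *)
Definition engel_hamiltonian_type M H g X Y Z :=
  [/\ sub_lorentzian M H g, engel M H &
      forall (a b : R) (c : R -> vec), a < b -> abnormal_curve M H a b c ->
        set_inj `[a, b] c ->
        exists (a' b' : R) (c' : R -> vec),
          [/\ hamiltonian_geodesic M H X Y a' b' c',
              timelike_fd_curve M H g Z a' b' c' &
              reparameterization a b c a' b' c']].

End engel.

Section normal_neighbourhoods.
Context {R : realType} {n : nat}.
Local Notation vec := 'rV[R]_n.
Implicit Types (M O U : set vec) (H : vec -> {vspace vec}).
Implicit Types (g h : vec -> vec -> vec -> R).

Definition gram h (q : vec) : 'M[R]_n :=
  \matrix_(i, j) h q (delta_mx ord0 i) (delta_mx ord0 j).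

Definition christoffel h (k i j : 'I_n) (q : vec) : R :=
  let dgram l i j := 'D_(delta_mx ord0 l : vec) (fun q' => gram h q' i j) q in
  2^-1 * \sum_l invmx (gram h q) k l *
    (dgram i j l + dgram j i l - dgram l i j).

Definition geodesic O h (a b : R) (c : R -> vec) :=
  forall t, t \in `]a, b[ ->
    [/\ O (c t), derivable c t 1, derivable (derive1 c) t 1 &
        forall k, derive1 (derive1 c) t ord0 k =
          - \sum_i \sum_j christoffel h k i j (c t) *
              (derive1 c t ord0 i * derive1 c t ord0 j)].

Definition is_exp O h (q v q' : vec) :=
  exists (a b : R) (c : R -> vec), [/\ a < 0, 1 < b & geodesic O h a b c] /\
    [/\ c 0 = q, derive1 c 0 = v & c 1 = q'].

(* exp_q maps a star-shaped open neighbourhood D of 0 diffeomorphically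
   onto U. *)
Definition exp_diffeo_onto O h (q : vec) U :=
  exists (D : set vec) (E F : vec -> vec),
    [/\ open D, D 0 & forall v (t : R), D v -> t \in `[0, 1] -> D (t *: v)] /\
    [/\ forall v, D v -> is_exp O h q v (E v),
        set_bij D U E, smooth_on D E,
        smooth_on U F & forall v, D v -> F (E v) = v].

(* O, with the metric h, is the ambient Lorentzian manifold. *)
Definition convex_normal_neighbourhood O h (q0 : vec) U :=
  [/\ open U, U `<=` O, U q0 & forall q, U q -> exp_diffeo_onto O h q U].

Definition normal_neighbourhood M H g (q0 : vec) U :=
  exists (O : set vec) (h : vec -> vec -> vec -> R) (U' : set vec),
    [/\ open O, O `<=` M, lorentzian_metric O (fun=> fullv) h &
        forall q v w, O q -> v \in H q -> w \in H q -> h q v w = g q v w] /\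
    [/\ convex_normal_neighbourhood O h q0 U,
        convex_normal_neighbourhood O h q0 U' &
        closure U `&` M `<=` U'].

End normal_neighbourhoods.

Section normal_form.
Context {R : realType}.
Local Notation vec := 'rV[R]_4.

Definition pt (x y z w : R) : vec := \row_(i < 4) [:: x; y; z; w]`_i.

Definition d_x : vec := pt 1 0 0 0.
Definition d_y : vec := pt 0 1 0 0.
Definition d_z : vec := pt 0 0 1 0.
Definition d_w : vec := pt 0 0 0 1.

Definition normal_form_frame (M : set vec) (phi psi1 psi2 : vec -> R)
    (X Y : vec -> vec) :=
  forall x y z w, let q := pt x y z w in M q ->
    X q = d_x + (y * phi q) *: (y *: d_x + x *: d_y)
          + (2^-1 * y * (1 + psi1 q)) *: d_z
          + (2^-1 * y ^+ 2 * (1 + psi2 q)) *: d_w /\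
    Y q = d_y - (x * phi q) *: (y *: d_x + x *: d_y)
          - (2^-1 * x * (1 + psi1 q)) *: d_z
          - (2^-1 * x * y * (1 + psi2 q)) *: d_w.

Definition independent_of_z (M : set vec) (f : vec -> R) :=
  forall x y z z' w, M (pt x y z w) -> M (pt x y z' w) ->
    f (pt x y z w) = f (pt x y z' w).

End normal_form.

(* Main.v *)
(* Since y x' - x y' = (y u - x v) (1 - (x^2 - y^2) phi) for c' = u X + v Y,
   every horizontal curve satisfies w' = y f (y x' - x y') / 2 with
   f = (1 + psi2) / (1 - (x^2 - y^2) phi).  Put f0(x,y,z,w) = f(x,0,z,w).  The
   derivative of the height w + x y^2 f0 / 4 is then
   y^2 x' (f/2 + f0/4) - x y y' (f - f0) / 2 + x y^2 (f0)' / 4.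
   Near 0 the function f is close to 1 and Lipschitz, so that f - f0 = O(y), and
   along nonspacelike future directed curves |c'| = O(x') with x' > 0: the first
   term dominates and the height does not decrease.  It vanishes at 0 and is
   negative at (t, 0, 0, -e), which is therefore not in the causal future of 0,
   however small e > 0 is.  Only the Lipschitz constant of f0 is used, so that
   (f0)' stands for a bound on difference quotients. *)

Require Import Defs.
From mathcomp Require Import all_boot all_order all_algebra.
From mathcomp Require Import all_classical all_reals all_analysis.
From mathcomp Require Import ring lra.
Import Order.TTheory GRing.Theory Num.Theory.
Import numFieldNormedType.Exports.
Local Open Scope classical_set_scope.
Local Open Scope ring_scope.

(** * Monotonicity of absolutely continuous functions *)

(** The supremum of the points of [[a, b]] where [P] holds can be passed unless it is [b]. The step
    jumps across [c], from [r] on its left to [s] on its right, so that [P] need not be known at [c]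
    itself. *)
Lemma interval_induction {R : realType} {P : R -> Prop} {a b : R} :
  a <= b -> P a ->
  (forall c, a <= c <= b -> exists2 eta : R, 0 < eta & forall r s,
     a <= r <= c -> c <= s <= b -> c - eta < r -> s < c + eta -> P r -> P s) ->
  P b.
Proof.
move=> leab Pa step.
pose S := [set t | a <= t <= b /\ P t].
have Sa : S a by split=> //; rewrite lexx.
have Sb : ubound S b by move=> t [/andP[]].
have supS : has_sup S by split; [exists a | exists b].
have leac : a <= sup S by apply: ub_le_sup => //; exists b.
have lecb : sup S <= b by apply: ge_sup => //; exists a.
have [|eta eta0 etaP] := step (sup S); first by rewrite leac.
have [r [/andP[ler lerb] Pr] ltr] := sup_adherent eta0 supS.
have lerc : r <= sup S by apply: ub_le_sup => //; [exists b | split=> //; lra].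
pose s := Num.min b (sup S + eta / 2).
have les : sup S <= s by rewrite le_min lecb lerDl; lra.
have lesb : s <= b by rewrite ge_min lexx.
have Ps : P s.
  apply: etaP Pr => //; rewrite ?ler ?les //.
  by rewrite gt_min; apply/orP; right; lra.
have lesc : s <= sup S by apply: ub_le_sup => //; [exists b | split=> //; lra].
suff <- : s = b by [].
move: lesc; rewrite ge_min => /orP[|]; last by lra.
by move=> bc; apply: min_l; lra.
Qed.

(** Lists let intervals be added one at a time. They run from right to left, a new interval on the
    right becoming the head. *)
Lemma abs_continuous_seq {R : realType} {a b e : R} {F : R -> R} :
  abs_continuous a b F -> 0 < e -> exists2 d : R, 0 < d &
    forall l : seq (R * R),
      all (fun p => [&& a <= p.1, p.1 <= p.2 & p.2 <= b]) l ->
      pairwise (fun p q => q.2 <= p.1) l ->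
      \sum_(p <- l) (p.2 - p.1) < d ->
      \sum_(p <- l) `|F p.2 - F p.1| < e.
Proof.
move=> acF e0; have [d d0 dP] := acF e e0; exists d => // l lab lp.
rewrite (big_nth (0, 0)) big_mkord => ltd.
rewrite (big_nth (0, 0)) big_mkord.
apply: (dP _ (fun i => (nth (0, 0) l i).1) (fun i => (nth (0, 0) l i).2)) => //.
  by move=> i; have /and3P[] := allP lab _ (mem_nth (0, 0) (ltn_ord i)).
move=> i j ij; have /pairwiseP-/(_ (0, 0)) lpP := lp.
have [lij|lji|/val_inj eij] := ltngtP i j.
- by right; apply: (lpP i j); rewrite ?inE.
- by left; apply: (lpP j i); rewrite ?inE.
- by rewrite eij eqxx in ij.
Qed.

(* The exceptional null set is covered by an open set of small measure.  By
   interval induction F a - F t is bounded by eps (t - a) plus the variation of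
   F over finitely many disjoint intervals inside that open set. *)
Lemma abs_continuous_le {R : realType} (a b : R) (F : R -> R) :
  a <= b -> abs_continuous a b F ->
  ae_on a b (fun t => forall e, 0 < e ->
    \forall s \near t, - (e * (s - t) ^+ 2) <= (F s - F t) * (s - t)) ->
  F a <= F b.
Proof.
move=> leab acF [N' [mN' muN' NP']].
have [N [mN N0 NP]] : exists N : set R,
    [/\ measurable N, lebesgue_measure N = 0%E & ~` N `<=`
    [set t | t \in `[a, b] -> forall e, 0 < e ->
      \forall s \near t, - (e * (s - t) ^+ 2) <= (F s - F t) * (s - t)]].
  exists N'; split => // t; apply: contra_notP => nP; exact: NP'.
apply/ler_addgt0Pr => e e0.
(* A loss of [eps] per unit length, and one more [eps] for the variation inside [O], add up to
   [e]. *)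
pose eps := e / (b - a + 1).
have ba0 : 0 < b - a + 1 by lra.
have eps0 : 0 < eps by rewrite divr_gt0.
have eE : e = eps * (b - a) + eps by rewrite /eps; field; lra.
have [d d0 dP] := abs_continuous_seq acF eps0.
have [|O [oO NO ltO]] := lebesgue_regularity_outer mN _ d0.
  by rewrite [X in (X < _)%E]N0 ltry.
have mO : measurable O by exact: measurable_realfun.open_measurable.
have Od : (lebesgue_measure O < d%:E)%E.
  rewrite -(setDUK NO) measureU ?[X in (X + _)%E]N0 ?add0e//.
  - by exact: measurableD.
  - by apply/seteqP; split=> x // [Nx [_]].
(* [l] collects the intervals used so far near points of [N]. Comparing their total length with the
   measure of [O] inside [[a, t]] gives an invariant additive in [t]; at [t = b] the length is below
   [d], so the variation is below [eps]. *)
pose P t := exists l : seq (R * R), [/\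
  all (fun p => [&& a <= p.1, p.1 <= p.2 & p.2 <= t]) l,
  pairwise (fun p q => q.2 <= p.1) l,
  ((\sum_(p <- l) (p.2 - p.1))%:E <= lebesgue_measure (O `&` `[a, t]))%E &
  F a - F t <= eps * (t - a) + \sum_(p <- l) `|F p.2 - F p.1|].
suff [l [lab lp lO lF]] : P b.
  have : \sum_(p <- l) `|F p.2 - F p.1| < eps.
    apply: dP => //; rewrite -lte_fin (le_lt_trans lO)//.
    apply: le_lt_trans Od; apply: le_measure; rewrite ?inE//.
    by apply: measurableI => //; exact: measurable_itv.
  by rewrite eE; lra.
apply: interval_induction leab _ _.
  by exists [::]; split; rewrite // !big_nil ?subrr ?mulr0 ?addr0// measure_ge0.
move=> c /andP[ac cb].
have [Nc|Nc] := pselect (N c).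
(* Near an exceptional point the interval from [r] to [s] lies in [O]: it is put into the list, and
   its variation is recorded instead of estimated. *)
- have /nbhs_ballP[eta /= eta0 etaP] : nbhs c O.
    by apply: open_nbhs_nbhs; split => //; exact: NO.
  exists eta => // r s /andP[ar rc] /andP[cs sb] ltr lts [l [lab lp lO lF]].
  exists ((r, s) :: l); split => /=.
  + rewrite ar lexx (le_trans rc cs)/=.
    apply: sub_all lab => p /and3P[-> -> /=].
    by move=> /le_trans; apply; lra.
  + by rewrite lp andbT; apply: sub_all lab => p /and3P[].
  + rewrite big_cons/= EFinD.
    (* The half-open interval is disjoint from [[a, r]], so that the two measures add up. *)
    have -> : (s - r)%:E = lebesgue_measure (`]r, s] : set R).
      rewrite lebesgue_measure_itv/= lte_fin; case: ltP => // sr.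
      by congr (_%:E); lra.
    apply: le_trans (leeD (lexx _) lO) _.
    rewrite -measureU; first last.
    * rewrite -subset0 => x [/=]; rewrite !in_itv/= => /andP[+ _] [_ /andP[_]].
      by move=> /lt_le_trans /[apply]; rewrite ltxx.
    * by apply: measurableI.
    * by [].
    apply: le_measure; rewrite ?inE; first exact/measurableU/measurableI.
      exact: measurableI.
    move=> x [|[Ox]] /=; rewrite !in_itv/= => /andP[h1 h2].
      split; last by apply/andP; split; lra.
      by apply: etaP; rewrite /ball/= ltr_norml; apply/andP; split; lra.
    by split => //; apply/andP; split; lra.
  + rewrite big_cons/=; have := ler_norm (- (F s - F r)); rewrite normrN.
    have : 0 <= eps * (s - r) by apply: mulr_ge0; lra.
    by lra.
(* At a good point the hypothesis, divided by the distance to [c], bounds the decrease of [F] on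
   each side of [c] by [eps] times the length. The list is unchanged. *)
- have /(_ eps eps0) : forall e, 0 < e ->
      \forall s \near c, - (e * (s - c) ^+ 2) <= (F s - F c) * (s - c).
    by apply: NP => //=; rewrite in_itv/= ac cb.
  move=> /nbhs_ballP[eta /= eta0 etaP].
  exists eta => // r s /andP[ar rc] /andP[cs sb] ltr lts [l [lab lp lO lF]].
  have Frc : F r - F c <= eps * (c - r).
    have : ball c eta r by rewrite /ball/= ltr_norml; apply/andP; split; lra.
    move=> /etaP/=; move: rc; rewrite le_eqVlt => /predU1P[->|rc]; first by nra.
    rewrite -subr_ge0 => h; rewrite -subr_ge0.
    by rewrite -(@pmulr_rge0 _ (c - r)) ?subr_gt0//; nra.
  have Fcs : F c - F s <= eps * (s - c).
    have : ball c eta s by rewrite /ball/= ltr_norml; apply/andP; split; lra.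
    move=> /etaP/=; move: cs; rewrite le_eqVlt => /predU1P[->|cs]; first by nra.
    rewrite -subr_ge0 => h; rewrite -subr_ge0.
    by rewrite -(@pmulr_rge0 _ (s - c)) ?subr_gt0//; nra.
  exists l; split => //.
  + by apply: sub_all lab => p /and3P[-> -> /=] /le_trans; apply; lra.
  + apply: le_trans lO _; apply: le_measure; rewrite ?inE.
    * exact: measurableI.
    * exact: measurableI.
    move=> x [Ox] /=; rewrite !in_itv/= => /andP[h1 h2].
    by split => //; apply/andP; split; lra.
  + by lra.
Qed.

(** * Almost everywhere statements and the sup norm of row vectors *)

Lemma ae_on_impl2 {R : realType} {a b : R} {P Q S : R -> Prop} :
  (forall t, t \in `[a, b] -> P t -> Q t -> S t) ->
  ae_on a b P -> ae_on a b Q -> ae_on a b S.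
Proof.
move=> PQS; rewrite /ae_on; apply: filterS2.
  exact: (ae_filter_ringOfSetsType lebesgue_measure).
by move=> t Pt Qt tab; apply: PQS => //; [exact: Pt|exact: Qt].
Qed.

Lemma ae_onW {R : realType} {a b : R} {P : R -> Prop} :
  (forall t, t \in `[a, b] -> P t) -> ae_on a b P.
Proof. by move=> abP; exact: aeW. Qed.

Lemma coord_le_norm {R : realType} {m n : nat} (A : 'M[R]_(m, n)) i j :
  `|A i j| <= `|A|.
Proof.
by rewrite [leRHS]/Num.Def.normr/= mx_normrE; apply: (le_bigmax _ _ (i, j)).
Qed.

Lemma norm_row_le {R : realType} {n : nat} (v : 'rV[R]_n) (r : R) :
  0 <= r -> (forall i, `|v ord0 i| <= r) -> `|v| <= r.
Proof.
move=> r0 vr; rewrite [leLHS]/Num.Def.normr/= mx_normrE bigmax_le// => -[i j] _.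
by rewrite ord1; apply: vr.
Qed.

Lemma norm_row_lt {R : realType} {n : nat} (v : 'rV[R]_n) (r : R) :
  0 < r -> (forall i, `|v ord0 i| < r) -> `|v| < r.
Proof.
move=> r0 vr; rewrite [ltLHS]/Num.Def.normr/= mx_normrE bigmax_lt// => -[i j] _.
by rewrite ord1; apply: vr.
Qed.

(** * Bounded Lipschitz functions on a ball about 0 *)

(** One constant serves as bound and as Lipschitz constant; including the bound makes the class
    closed under products. *)
Definition bounded_lipschitz {R : realType} {V : normedModType R} (r : R)
    (f : V -> R) :=
  exists2 K : R, 0 <= K &
    (forall p, `|p| < r -> `|f p| <= K) /\
    (forall p q, `|p| < r -> `|q| < r -> `|f p - f q| <= K * `|p - q|).

Section bounded_lipschitz_theory.
Context {R : realType} {V : normedModType R} {r : R}.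
Implicit Types f g : V -> R.
Local Notation blip := (@bounded_lipschitz R V r).

Lemma bounded_lipschitz_le {r' : R} {f} :
  r' <= r -> blip f -> bounded_lipschitz r' f.
Proof.
move=> rr' [K K0 [fK fL]]; exists K => //; split=> [p pr|p q pr qr].
  by apply: fK; apply: lt_le_trans rr'.
by apply: fL; apply: lt_le_trans rr'.
Qed.

Lemma bounded_lipschitz_cst (a : R) : blip (fun=> a).
Proof.
by exists `|a| => //; split=> // p q _ _; rewrite subrr normr0 mulr_ge0.
Qed.

Lemma bounded_lipschitzD f g :
  blip f -> blip g -> blip (fun q => f q + g q).
Proof.
move=> [K K0 [fK fL]] [L L0 [gK gL]]; exists (K + L); first by lra.
split=> [p pr|p q pr qr].
  by rewrite (le_trans (ler_normD _ _))// lerD ?fK ?gK.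
rewrite opprD addrACA mulrDl (le_trans (ler_normD _ _))//.
by rewrite lerD ?fL ?gL.
Qed.

Lemma bounded_lipschitzM f g :
  blip f -> blip g -> blip (fun q => f q * g q).
Proof.
move=> [K K0 [fK fL]] [L L0 [gK gL]]; exists (2 * K * L + K * L).
  by rewrite addr_ge0 ?mulr_ge0.
split=> [p pr|p q pr qr].
  rewrite normrM (le_trans (ler_pM _ _ (fK _ pr) (gK _ pr)))// lerDr.
  by rewrite !mulr_ge0.
have -> : f p * g p - f q * g q = (f p - f q) * g p + f q * (g p - g q).
  by ring.
have h : 0 <= K * L * `|p - q| by rewrite !mulr_ge0.
rewrite (le_trans (ler_normD _ _))// !normrM.
have := ler_pM (normr_ge0 _) (normr_ge0 _) (fL _ _ pr qr) (gK _ pr).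
have := ler_pM (normr_ge0 _) (normr_ge0 _) (fK _ qr) (gL _ _ pr qr).
by lra.
Qed.

Lemma bounded_lipschitzV f (a : R) : 0 < a ->
  (forall q, `|q| < r -> a <= f q) -> blip f -> blip (fun q => (f q)^-1).
Proof.
move=> a0 fa [K K0 [fK fL]].
have f0 q : `|q| < r -> 0 < f q by move=> /fa; apply: lt_le_trans.
have fVa q : `|q| < r -> `|(f q)^-1| <= a^-1.
  by move=> qr; rewrite normfV gtr0_norm ?f0// lef_pV2 ?posrE ?f0 ?fa.
have aV0 : 0 <= a^-1 by rewrite invr_ge0 ltW.
exists (a^-1 + K * a^-1 ^+ 2); first by rewrite addr_ge0 ?mulr_ge0 ?exprn_ge0.
split=> [p pr|p q pr qr].
  by rewrite (le_trans (fVa _ pr))// lerDl mulr_ge0 ?exprn_ge0.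
have -> : (f p)^-1 - (f q)^-1 = (f q - f p) * ((f p)^-1 * (f q)^-1).
  have := f0 _ pr; have := f0 _ qr => ? ?.
  by field; apply/andP; split; lra.
rewrite !normrM distrC.
have h := ler_pM (normr_ge0 _) (normr_ge0 _) (fVa _ pr) (fVa _ qr).
have V0 : 0 <= `|(f p)^-1| * `|(f q)^-1| by rewrite mulr_ge0.
rewrite (le_trans (ler_pM (normr_ge0 _) V0 (fL _ _ pr qr) h))//.
have : 0 <= a^-1 * `|p - q| by rewrite mulr_ge0.
by rewrite expr2; lra.
Qed.

End bounded_lipschitz_theory.

Lemma bounded_lipschitz_coord {R : realType} {n : nat} (r : R) i :
  0 <= r -> bounded_lipschitz r (fun q : 'rV[R]_n => q ord0 i).
Proof.
move=> r0; exists (1 + r); first lra.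
split=> [p pr|p q _ _].
  have := coord_le_norm p ord0 i; lra.
have -> : p ord0 i - q ord0 i = (p - q) ord0 i by rewrite !mxE.
have := coord_le_norm (p - q) ord0 i; move/le_trans; apply.
by rewrite mulrDl mul1r lerDl mulr_ge0.
Qed.

(** * Lipschitz bounds from continuous partial derivatives *)

Lemma directional_mean_value {R : realType} {V : normedModType R} (M : set V)
    (f : V -> R) (v q : V) (K t : R) : 0 < t ->
  (forall s, 0 <= s <= t -> M (s *: v + q)) ->
  (forall p, M p -> derivable f p v) -> (forall p, M p -> `|'D_v f p| <= K) ->
  `|f (t *: v + q) - f q| <= K * t.
Proof.
move=> t0 Mst df dfK.
pose h (s : R) := f (s *: v + q).
have hs s : 0 <= s <= t -> is_derive s 1 h ('D_v f (s *: v + q)).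
  move=> st.
  have E : (fun u : R => u^-1 *: (h (u *: 1 + s) - h s)) =
      (fun u : R => u^-1 *: (f (u *: v + (s *: v + q)) - f (s *: v + q))).
    by apply/funext => u; rewrite /h scalerDl -addrA [u *: 1]mulr1.
  have := df _ (Mst s st); rewrite /derivable -E => dh.
  by split => //; rewrite /derive -E.
have hc : {within `[0, t], continuous h}.
  by apply: derivable_within_continuous => s; rewrite in_itv/= => /hs[].
have [|c + cE] :=
  MVT_segment (df := fun s => 'D_v f (s *: v + q)) (ltW t0) _ hc.
  by move=> s; rewrite in_itv/= => /andP[s0 st]; apply: hs; rewrite !ltW.
rewrite in_itv/= => ct.
have -> : f (t *: v + q) - f q = h t - h 0 by rewrite /h scale0r add0r.
by rewrite cE subr0 normrM (gtr0_norm t0) ler_pM2r//; apply/dfK/Mst.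
Qed.

(** The partial derivatives are bounded near 0 by continuity. Two points are joined by moving one
    coordinate at a time, the mean value theorem is applied to each move, and the increments
    telescope. *)
Lemma C1_bounded_lipschitz {R : realType} {n : nat} {M : set 'rV[R]_n}
    {f : 'rV[R]_n -> R} : open M -> M 0 -> Ck_on 1 M f ->
  exists2 r : R, 0 < r & bounded_lipschitz r f.
Proof.
move=> oM M0 [fc f1].
pose e i : 'rV[R]_n := delta_mx ord0 i.
have nearM : \forall q \near (0 : 'rV[R]_n), M q by exact: open_nbhs_nbhs.
have near_le (h : 'rV[R]_n -> R) : {for 0, continuous h} ->
    \forall q \near (0 : 'rV[R]_n), `|h q| <= `|h 0| + 1.
  move=> /cvgr_dist_le /(_ 1 ltr01); apply: filterS => q.
  by have := ler_distD (h 0) (h q) 0; rewrite !subr0 distrC; lra.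
have : \forall q \near (0 : 'rV[R]_n),
    [/\ M q, `|f q| <= `|f 0| + 1 &
        forall i, `|'D_(e i) f q| <= `|'D_(e i) f 0| + 1].
  have h3 : \forall q \near (0 : 'rV[R]_n),
      forall i, `|'D_(e i) f q| <= `|'D_(e i) f 0| + 1.
    pose small i q := `|'D_(e i) f q| <= `|'D_(e i) f 0| + 1.
    refine (@filter_forall _ _ small (nbhs (0 : 'rV[R]_n)) _ _) => i.
    apply: (near_le (fun q => 'D_(e i) f q)).
    exact: ((f1 (e i)).2.1 _ M0).
  have := near_le f (fc _ M0).
  move: nearM h3; apply: filterS3 => q; split => //.
move=> /nbhs_norm0P[r /= r0 rP]; exists r => //.
pose K := \sum_i (`|'D_(e i) f 0| + 1).
have KD q i : `|q| < r -> `|'D_(e i) f q| <= K.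
  move=> /rP[_ _ /(_ i)] /le_trans; apply; rewrite /K (bigD1 i)//= lerDl.
  by apply: sumr_ge0 => j _; rewrite addr_ge0.
have K0 : 0 <= K by apply: sumr_ge0 => j _; rewrite addr_ge0.
have mv q i t : `|q| < r -> `|t *: e i + q| < r ->
    `|f (t *: e i + q) - f q| <= K * `|t|.
  have pos p u : 0 < u -> `|p| < r -> `|u *: e i + p| < r ->
      `|f (u *: e i + p) - f p| <= K * u.
    move=> u0 pr pur.
    apply: (@directional_mean_value _ _ [set p | `|p| < r]) => //=.
    (* Convexity of the ball: [u] times the point of the segment is the combination of the endpoints
       with weights [u - s] and [s], which avoids a division. *)
    + move=> s /andP[s0 su]; rewrite -(ltr_pM2l u0) -(gtr0_norm u0) -normrZ.
      have -> : u *: (s *: e i + p) = (u - s) *: p + s *: (u *: e i + p).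
        rewrite scalerBl !scalerDr !scalerA (mulrC u s) [RHS]addrC -[RHS]addrA.
        by rewrite [s *: p + _]addrC subrK.
      rewrite (le_lt_trans (ler_normD _ _))// !normrZ (gtr0_norm u0).
      rewrite (ger0_norm s0) (@ger0_norm _ (u - s)) ?subr_ge0//.
      have h1 := ler_wpM2l s0 (ltW pur).
      move: su; rewrite le_eqVlt => /predU1P[->|su].
        by rewrite subrr mul0r add0r ltr_pM2l.
      have := pr; rewrite -(@ltr_pM2l _ (u - s)) ?subr_gt0//; lra.
    + by move=> p' p'r; have [Mp' _ _] := rP _ p'r; apply: (f1 (e i)).1.
    + by move=> p' p'r; exact: KD.
  (* For negative [t] the two endpoints exchange their roles. *)
  move=> qr tqr; have [t0|t0|->] := ltgtP t 0.
  - have := pos (t *: e i + q) (- t); rewrite oppr_gt0 addrA -scalerDl addNr.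
    by rewrite scale0r add0r distrC (ltr0_norm t0); apply.
  - by rewrite (gtr0_norm t0); apply: pos.
  - by rewrite scale0r add0r subrr normr0 mulr0.
exists (`|f 0| + 1 + n%:R * K); first by rewrite !addr_ge0 ?mulr_ge0.
split=> [p /rP[_ fp _]|p q pr qr].
  by rewrite (le_trans fp)// lerDl mulr_ge0.
(* [path] leads from [q] to [p], changing one coordinate at each step; the sup norm keeps it inside
   the ball. *)
pose path k : 'rV[R]_n := \row_i (if (i < k)%N then p ord0 i else q ord0 i).
have pathr k : `|path k| < r.
  apply: norm_row_lt => // i; rewrite mxE; case: ifP => _.
    by apply: le_lt_trans (coord_le_norm _ _ _) _.
  by apply: le_lt_trans (coord_le_norm _ _ _) _.
have pathS (k : 'I_n) :
    path k.+1 = (p ord0 k - q ord0 k) *: e k + path k.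
  apply/rowP => i; rewrite !mxE eqxx/= ltnS leq_eqVlt.
  case: (eqVneq i k) => [->|ik]; first by rewrite eqxx ltnn/= mulr1 subrK.
  by rewrite val_eqE (negbTE ik)/= mulr0 add0r.
have -> : f p - f q = \sum_(k < n) (f (path k.+1) - f (path k)).
  rewrite -(big_mkord xpredT (fun k => f (path k.+1) - f (path k))).
  rewrite telescope_sumr//; congr (f _ - f _); apply/rowP => i;
    by rewrite mxE ?ltn_ord.
apply: (@le_trans _ _ (\sum_(k < n) K * `|p - q|)).
  apply: le_trans (ler_norm_sum _ _ _) _; apply: ler_sum => k _.
  rewrite pathS (le_trans (mv _ _ _ _ _)) -?pathS//.
  rewrite ler_wpM2l//.
  have -> : p ord0 k - q ord0 k = (p - q) ord0 k by rewrite !mxE.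
  exact: coord_le_norm.
rewrite sumr_const card_ord mulrDl -mulrA mulr_natl.
by rewrite lerDr mulr_ge0// addr_ge0.
Qed.

(** * The height function *)

Section height.
Context {R : realType}.
Local Notation vec := 'rV[R]_4.
Implicit Types (p q : vec) (phi psi f : vec -> R).

Local Notation cx q := (q ord0 (@Ordinal 4 0 isT)).
Local Notation cy q := (q ord0 (@Ordinal 4 1 isT)).
Local Notation cz q := (q ord0 (@Ordinal 4 2 isT)).
Local Notation cw q := (q ord0 (@Ordinal 4 3 isT)).

Lemma forall_ord4 (P : 'I_4 -> Prop) :
  P (@Ordinal 4 0 isT) -> P (@Ordinal 4 1 isT) -> P (@Ordinal 4 2 isT) ->
  P (@Ordinal 4 3 isT) -> forall i, P i.
Proof.
move=> P0 P1 P2 P3 [[|[|[|[|//]]]] i4].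
- by rewrite (_ : Ordinal i4 = @Ordinal 4 0 isT)//; exact: val_inj.
- by rewrite (_ : Ordinal i4 = @Ordinal 4 1 isT)//; exact: val_inj.
- by rewrite (_ : Ordinal i4 = @Ordinal 4 2 isT)//; exact: val_inj.
- by rewrite (_ : Ordinal i4 = @Ordinal 4 3 isT)//; exact: val_inj.
Qed.

Lemma pt_eta q : pt (cx q) (cy q) (cz q) (cw q) = q.
Proof.
by apply/rowP; apply: forall_ord4; rewrite mxE.
Qed.

(** This is the factor f in [w' = y f (y x' - x y') / 2], valid along horizontal curves;
    [restrict_y0] below turns it into f0. *)
Definition slope phi psi q :=
  (1 + psi q) / (1 - (cx q ^+ 2 - cy q ^+ 2) * phi q).

Definition restrict_y0 f q := f (pt (cx q) 0 (cz q) (cw q)).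

(** The correction to [w] is chosen so that the terms in [x y y'], whose sign is not controlled,
    cancel up to the factor [f - f0], which is O(y). *)
Definition height f q := cw q + 4^-1 * (cx q * cy q ^+ 2) * restrict_y0 f q.

(** * Pointwise estimates for velocities [u X + v Y] with [|v| <= u] *)

(** Here [p] is a value of [phi]: under the condition on [r], the [x] and [y] components of the
    frame differ from those of the standard frame by at most 1/4. *)
Lemma mul_small {s t u v p r : R} :
  `|s| < r -> `|t| < r -> r ^+ 2 * `|p| <= 4^-1 -> `|v| <= u ->
  `|u * (s * t * p)| <= u / 4 /\ `|v * (s * t * p)| <= u / 4.
Proof.
move=> sr tr rp vu; have u0 : 0 <= u := le_trans (normr_ge0 v) vu.
have stp : `|s * t * p| <= 4^-1.
  rewrite !normrM; apply: le_trans rp; rewrite ler_wpM2r// expr2.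
  by apply: ler_pM => //; exact: ltW.
rewrite normrM (normrM v) (ger0_norm u0).
by split; [exact: ler_wpM2l|exact: ler_pM].
Qed.

Lemma horizontal_speed_bound {x y u v p r : R} :
  `|x| < r -> `|y| < r -> r ^+ 2 * `|p| <= 4^-1 -> `|v| <= u ->
  `|u * (1 + y ^+ 2 * p) - v * (x * y * p)| <= 2 * u /\
  `|u * (x * y * p) + v * (1 - x ^+ 2 * p)| <= 2 * u.
Proof.
move=> xr yr rp vu.
have [h1 h2] := mul_small xr yr rp vu.
have [h3 _] := mul_small yr yr rp vu.
have [_ h6] := mul_small xr xr rp vu.
move: h1 h2 h3 h6 vu; rewrite !expr2 !ler_norml.
move=> /andP[? ?] /andP[? ?] /andP[? ?] /andP[? ?] /andP[? ?].
by split; apply/andP; split; lra.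
Qed.

Lemma vertical_speed_bound {x y u v b r : R} :
  `|x| < r -> `|y| < r -> r <= 1 -> `|v| <= u -> `|b| <= 1 ->
  `|2^-1 * (1 + b) * (y * u - x * v)| <= 2 * u /\
  `|2^-1 * y * (1 + b) * (y * u - x * v)| <= 2 * u.
Proof.
move=> xr yr r1 vu b1; have u0 : 0 <= u := le_trans (normr_ge0 v) vu.
have x1 : `|x| <= 1 by apply: ltW; apply: lt_le_trans r1.
have y1 : `|y| <= 1 by apply: ltW; apply: lt_le_trans r1.
have m : `|y * u - x * v| <= 2 * u.
  apply: le_trans (ler_normB _ _) _; rewrite !normrM (ger0_norm u0).
  have h1 : `|y| * u <= 1 * u by exact: ler_wpM2r.
  have h2 : `|x| * `|v| <= 1 * u by exact: ler_pM.
  lra.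
have b2 : `|2^-1 * (1 + b)| <= 1.
  by move: b1; rewrite !ler_norml => /andP[? ?]; apply/andP; split; lra.
have h : `|2^-1 * (1 + b) * (y * u - x * v)| <= 2 * u.
  by rewrite normrM -[leRHS]mul1r; apply: ler_pM.
split=> //; have -> : 2^-1 * y * (1 + b) * (y * u - x * v) =
  y * (2^-1 * (1 + b) * (y * u - x * v)) by ring.
by rewrite normrM -[leRHS]mul1r; apply: ler_pM.
Qed.

(** Since [x' >= u / 2] and [f / 2 + f0 / 4 >= 3 / 8], the main term is at least [3 u y^2 / 16]; the
    term in [f - f0] is at most [u y^2 / 8]. The remaining [u y^2 / 16] covers the left-hand side,
    which is the possible cost of the variation of [f0] at speed at most [2 * u]. *)
Lemma height_derivative_bound {x y u v x' y' w' p b f f0 L r : R} :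
  `|x| < r -> `|y| < r -> r ^+ 2 * `|p| <= 4^-1 ->
  `|v| <= u -> f * (1 - (x ^+ 2 - y ^+ 2) * p) = b ->
  x' = u * (1 + y ^+ 2 * p) - v * (x * y * p) ->
  y' = u * (x * y * p) + v * (1 - x ^+ 2 * p) ->
  w' = 2^-1 * y * b * (y * u - x * v) ->
  2^-1 <= f -> 2^-1 <= f0 -> `|f - f0| <= L * `|y| -> 0 <= L ->
  r * L <= 8^-1 ->
  4^-1 * `|x * y ^+ 2| * L * (2 * u) <=
  w' + 4^-1 * f0 * (x' * y ^+ 2 + x * (2 * (y * y'))).
Proof.
move=> xr yr rp vu fb x'E y'E w'E f2 f02 ff0 L0 rL.
have u0 : 0 <= u := le_trans (normr_ge0 v) vu.
have w'f : w' = 2^-1 * y * f * (y * x' - x * y').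
  by rewrite w'E x'E y'E -fb; ring.
have [_ h2] := mul_small xr yr rp vu.
have [h3 _] := mul_small yr yr rp vu.
have x'u : u / 2 <= x'.
  rewrite x'E expr2; move: h3 h2; rewrite !ler_norml => /andP[? ?] /andP[? ?].
  lra.
have y'u : `|y'| <= 2 * u.
  by have [_] := horizontal_speed_bound xr yr rp vu; rewrite y'E.
have y2 : 0 <= y ^+ 2 by rewrite sqr_ge0.
have E : w' + 4^-1 * f0 * (x' * y ^+ 2 + x * (2 * (y * y'))) =
    y ^+ 2 * x' * (2^-1 * f + 4^-1 * f0) - 2^-1 * x * y * y' * (f - f0).
  by rewrite w'f; field.
have bound1 : y ^+ 2 * (u / 2) * (3 / 8) <=
    y ^+ 2 * x' * (2^-1 * f + 4^-1 * f0).
  apply: ler_pM; [by apply: mulr_ge0 => //; lra|lra| |lra].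
  exact: ler_wpM2l.
have bound2 : 2^-1 * x * y * y' * (f - f0) <= `|x| * L * u * y ^+ 2.
  apply: le_trans (ler_norm _) _; rewrite !normrM.
  have -> : `|x| * L * u * y ^+ 2 =
      `|2^-1| * `|x| * `|y| * (2 * u) * (L * `|y|).
    by rewrite ger0_norm ?invr_ge0// -(real_normK (num_real y)); field.
  by apply: ler_pM => //; rewrite ?mulr_ge0// ler_wpM2l ?mulr_ge0.
have bound3 : `|x| * L * u * y ^+ 2 <= 8^-1 * (u * y ^+ 2).
  have xL : `|x| * L <= 8^-1.
    by apply: le_trans rL; apply: ler_wpM2r => //; exact: ltW.
  by rewrite -mulrA; apply: ler_wpM2r => //; exact: mulr_ge0.
have -> : 4^-1 * `|x * y ^+ 2| * L * (2 * u) = 2^-1 * (`|x| * L * u * y ^+ 2).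
  by rewrite normrM (ger0_norm y2); field.
by rewrite E; lra.
Qed.

(** * Increments of the height along a curve *)

Lemma abs_continuous_comp {V : normedModType R} {a b r : R} {f : V -> R}
    {c : R -> V} :
  bounded_lipschitz r f -> abs_continuous a b c ->
  (forall t, t \in `[a, b] -> `|c t| < r) ->
  abs_continuous a b (f \o c).
Proof.
move=> [K K0 [_ fL]] acc cr e e0.
have [d d0 dP] := acc (e / (K + 1)) (divr_gt0 e0 (ltr_wpDl K0 ltr01)).
exists d => // m u v uv dis /(dP m u v uv dis).
rewrite ltr_pdivlMr ?ltr_wpDl// mulrC; apply: le_lt_trans.
rewrite mulr_sumr; apply: ler_sum => i _; have [au [uvi vb]] := uv i.
apply: (@le_trans _ _ (K * `|c (v i) - c (u i)|)).
  apply: fL; apply: cr; rewrite in_itv/=; apply/andP; split => //.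
    exact: le_trans au uvi.
  exact: le_trans uvi vb.
by rewrite ler_wpM2r// lerDl.
Qed.

(** As [restrict_y0 f] is only assumed Lipschitz, the height along [c] may have no derivative. Its
    increment is split into that of a differentiable function, with f0 frozen at [c t], and a
    remainder controlled by [L]; by assumption the derivative of the former outweighs the limiting
    rate of the latter. *)
Lemma near_height_increment {c : R -> vec} {t r L e : R} {f} :
  derivable c t 1 -> `|c t| < r -> 0 < e -> 0 <= L ->
  (forall p q, `|p| < r -> `|q| < r ->
     `|restrict_y0 f p - restrict_y0 f q| <= L * `|p - q|) ->
  let c' := derive1 c t in
  4^-1 * `|cx (c t) * cy (c t) ^+ 2| * L * `|c'| <=
    cw c' + 4^-1 * restrict_y0 f (c t) *
    (cx c' * cy (c t) ^+ 2 + cx (c t) * (2 * (cy (c t) * cy c'))) ->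
  \forall s \near t, - (e * (s - t) ^+ 2) <=
    (height f (c s) - height f (c t)) * (s - t).
Proof.
move=> dc ctr e0 L0 fL c'; set D := cw c' + _ => leD.
have dcoord i : is_derive t 1 (fun s => c s ord0 i) (c' ord0 i).
  split; first by move/derivable_mxP: dc; apply.
  by rewrite /c' derive1E derive_mx// mxE.
pose A s := cw (c s) + 4^-1 * restrict_y0 f (c t) * (cx (c s) * cy (c s) ^+ 2).
have dA : is_derive t 1 A D.
  have := dcoord (@Ordinal 4 0 isT); have := dcoord (@Ordinal 4 1 isT).
  have := dcoord (@Ordinal 4 3 isT) => d3 d1 d0.
  rewrite /A; apply: is_derive_eq.
  rewrite /D /GRing.scale/=; ring.
have cc : {for t, continuous c}.
  exact/differentiable_continuous/derivable1_diffP.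
have ccoord i : (fun s => c s ord0 i) @ t --> c t ord0 i.
  by apply: (cvg_comp _ _ cc (@coord_continuous R 1 4 ord0 i (c t))).
(* [B s] is the factor of [|c s - c t|] in the bound of the remainder. Below, each of the two limits
   is allowed an error [e / 2]. *)
pose B s := 4^-1 * `|cx (c s) * cy (c s) ^+ 2| * L.
have cB : B @ t --> B t.
  apply: cvgM; last exact: cvg_cst.
  apply: cvgM; first exact: cvg_cst.
  apply: cvg_norm; apply: cvgM; first exact: ccoord.
  by rewrite expr2; apply: cvgM; exact: ccoord.
have near1 : \forall h \near 0^', D - e / 2 < h^-1 *: (A (h *: 1 + t) - A t).
  have [dA1 dA2] := dA.
  have := dA1; rewrite /derivable => /cvg_ex[l lP].
  have -> : D = l by rewrite -dA2 /derive; apply/cvg_lim.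
  by apply: (cvgr_gt _ lP); lra.
have near2 : \forall h \near 0^',
    B (h *: 1 + t) * `|h^-1 *: (c (h *: 1 + t) - c t)| < B t * `|c'| + e / 2.
  have : B (h *: 1 + t) * `|h^-1 *: (c (h *: 1 + t) - c t)| @[h --> 0^'] -->
      B t * `|c'|.
    apply: cvgM; last by apply: cvg_norm; rewrite /c' derive1E; exact: dc.
    apply: cvg_within_filter.
    have : (fun h : R => h *: 1 + t) @ (0 : R) --> t.
      rewrite -[X in _ --> X]add0r -[X in _ --> X + _](scale0r (1 : R)).
      apply: cvgD; last exact: cvg_cst.
      by apply: cvgZr_tmp; exact: cvg_id.
    by move=> /cvg_comp; apply.
  by move=> /cvgr_lt; apply; lra.
have near3 : \forall s \near t, `|c s| < r.
  by apply: (cvgr_lt _ (cvg_norm cc)).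
have near4 : \forall h \near 0^', h != 0 -> 
    D - e / 2 < h^-1 *: (A (h *: 1 + t) - A t) /\
    B (h *: 1 + t) * `|h^-1 *: (c (h *: 1 + t) - c t)| < B t * `|c'| + e / 2.
  by move: near1 near2; apply: filterS2 => h ? ? _.
have [d /= d0 dP] : nbhs_ball (0 : R) _ := (nbhs_ballP _ _).1 near4.
have neard : \forall s \near t, `|t - s| < d.
  by exists d.
move: near3 neard; apply: filterS2 => s csr std.
have [->|st] := eqVneq s t; first by rewrite !subrr mulr0 expr0n mulr0 oppr0.
have st0 : s - t != 0 by rewrite subr_eq0.
have := dP (s - t); rewrite /ball/= sub0r normrN distrC => /(_ std st0 st0).
rewrite [(s - t) *: 1]mulr1 subrK => -[hA hB].
(* Multiplication by this square turns bounds on difference quotients into the product form, on both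
   sides of [t] at once. *)
have s2 : 0 < (s - t) ^+ 2 by rewrite exprn_even_gt0.
have AE : (A s - A t) * (s - t) = (s - t)^-1 *: (A s - A t) * (s - t) ^+ 2.
  by rewrite /GRing.scale/=; field.
have BE : `|c s - c t| * `|s - t| = `|(s - t)^-1 *: (c s - c t)| * (s - t) ^+ 2.
  rewrite normrZ normfV -(real_normK (num_real (s - t))); field.
  by rewrite normr_eq0.
have -> : height f (c s) - height f (c t) = A s - A t +
    4^-1 * (cx (c s) * cy (c s) ^+ 2) *
    (restrict_y0 f (c s) - restrict_y0 f (c t)).
  by rewrite /height /A; ring.
have key : - (4^-1 * (cx (c s) * cy (c s) ^+ 2) *
    (restrict_y0 f (c s) - restrict_y0 f (c t)) * (s - t)) <=
    B s * (`|c s - c t| * `|s - t|).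
  apply: le_trans (ler_norm _) _; rewrite normrN /B !normrM.
  rewrite (@ger0_norm _ 4^-1) ?invr_ge0// -!mulrA.
  do 4![apply: ler_wpM2l => //]; rewrite ?invr_ge0//.
  rewrite !mulrA; apply: ler_wpM2r => //; exact: fL.
rewrite mulrDl AE; move: key; rewrite BE mulrA => key.
move: hA hB; rewrite -(ltr_pM2r s2) -(ltr_pM2r s2 _ (B t * _ + _)) => hA hB.
have : B t * `|c'| * (s - t) ^+ 2 <= D * (s - t) ^+ 2 by rewrite ler_pM2r.
by lra.
Qed.

(** * The frame in coordinates and the future cone *)

Lemma frame_coord {M X Y phi psi1 psi2 q} :
  normal_form_frame M phi psi1 psi2 X Y -> M q ->
  let x := cx q in let y := cy q in
  [/\ cx (X q) = 1 + y ^+ 2 * phi q, cy (X q) = x * y * phi q,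
      cz (X q) = 2^-1 * y * (1 + psi1 q) &
      cw (X q) = 2^-1 * y ^+ 2 * (1 + psi2 q)] /\
  [/\ cx (Y q) = - (x * y * phi q), cy (Y q) = 1 - x ^+ 2 * phi q,
      cz (Y q) = - (2^-1 * x * (1 + psi1 q)) &
      cw (Y q) = - (2^-1 * x * y * (1 + psi2 q))].
Proof.
move=> nf Mq x y; have := nf x y (cz q) (cw q).
rewrite /= /x /y pt_eta => /(_ Mq)[-> ->].
by rewrite !mxE/=; split; split; ring.
Qed.

Lemma in_frame_span {M H g X Y q v} :
  orthonormal_frame M H g X Y -> M q -> v \in H q ->
  exists a b : R, v = a *: X q + b *: Y q.
Proof.
move=> [_ _ fr] Mq; have [-> _ _ _] := fr q Mq.
rewrite span_cons span_seq1 => /memv_addP[_ /vlineP[a ->] [_ /vlineP[b ->] ->]].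
by exists a, b.
Qed.

(** In the frame, [g(v, v) = b^2 - a^2] and [g(v, X) = - a]: the first gives [b^2 <= a^2], the
    second [a > 0]. *)
Lemma future_nonspacelike_coord {M H g X Y q v} :
  lorentzian_metric M H g -> orthonormal_frame M H g X Y -> M q ->
  nonspacelike H g q v -> future_directed g X q v ->
  exists a b : R, v = a *: X q + b *: Y q /\ `|b| <= a.
Proof.
move=> [lin sym _ _] fr Mq [vH gvv _] fd.
have [a [b vE]] := in_frame_span fr Mq vH.
exists a, b; split=> //.
have [_ _ /(_ q Mq)[HE gXX gYY gXY]] := fr.
have XH : X q \in H q by rewrite HE memv_span// !inE eqxx.
have YH : Y q \in H q by rewrite HE memv_span// !inE eqxx orbT.
have g0 w : w \in H q -> g q 0 w = 0.
  move=> wH; have := lin q Mq 1 0 0 w (mem0v _) (mem0v _) wH.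
  by rewrite scaler0 addr0 mul1r; lra.
have gv w : w \in H q -> g q v w = a * g q (X q) w + b * g q (Y q) w.
  move=> wH; rewrite vE lin// ?memvZ//; congr (_ + _).
  by rewrite -[b *: _]addr0 lin// ?mem0v// g0// addr0.
have gvX : g q v (X q) = - a by rewrite gv// gXX sym// gXY; lra.
have gvY : g q v (Y q) = b by rewrite gv// gYY gXY; lra.
have : g q v v = b ^+ 2 - a ^+ 2.
  by rewrite gv// (sym _ _ (X q))// (sym _ _ (Y q))// gvX gvY; ring.
move: fd gvv; rewrite /future_directed gvX => a0 + gE.
rewrite gE subr_le0 => ab.
by rewrite -ler_sqr ?nnegrE ?real_normK ?num_real//; lra.
Qed.

(** * Bounds on the slope and choice of the radius *)

Lemma restrict_norm_lt {q} {r : R} :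
  `|q| < r -> `|pt (cx q) 0 (cz q) (cw q)| < r.
Proof.
move=> qr; have r0 := le_lt_trans (normr_ge0 _) qr.
apply: norm_row_lt => //; apply: forall_ord4; rewrite !mxE/= ?normr0//;
  exact: le_lt_trans (coord_le_norm _ _ _) qr.
Qed.

Lemma restrict_norm_le p q :
  `|pt (cx p) 0 (cz p) (cw p) - pt (cx q) 0 (cz q) (cw q)| <= `|p - q|.
Proof.
have h i : `|p ord0 i - q ord0 i| <= `|p - q|.
  by have := coord_le_norm (p - q) ord0 i; rewrite !mxE.
apply: norm_row_le => //; apply: forall_ord4; rewrite !mxE/= ?subrr ?normr0//;
  exact: h.
Qed.

Lemma bounded_lipschitz_restrict f (r : R) :
  bounded_lipschitz r f -> bounded_lipschitz r (restrict_y0 f).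
Proof.
move=> [K K0 [fK fL]]; exists K => //; split=> [p pr|p q pr qr].
  exact/fK/restrict_norm_lt.
apply: le_trans (fL _ _ _ _) _; [exact: restrict_norm_lt..|].
by apply: ler_wpM2l => //; exact: restrict_norm_le.
Qed.

Lemma dist_restrict q : `|q - pt (cx q) 0 (cz q) (cw q)| <= `|cy q|.
Proof.
apply: norm_row_le => //; apply: forall_ord4;
  by rewrite !mxE/= ?subrr ?subr0 ?normr0.
Qed.

Lemma denominator_bound {x y p r : R} :
  `|x| < r -> `|y| < r -> r ^+ 2 * `|p| <= 4^-1 ->
  `|(x ^+ 2 - y ^+ 2) * p| <= 4^-1.
Proof.
move=> xr yr; apply: le_trans; rewrite normrM ler_wpM2r//.
have r0 := le_trans (normr_ge0 _) (ltW xr).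
have sq s : `|s| < r -> 0 <= s ^+ 2 <= r ^+ 2.
  move=> sr; rewrite sqr_ge0 -(real_normK (num_real s)) ler_sqr ?nnegrE//.
  exact: ltW.
have /andP[? ?] := sq _ xr; have /andP[? ?] := sq _ yr.
by rewrite ler_norml; apply/andP; split; lra.
Qed.

(** The numerator is at least 3/4 and the denominator lies between 3/4 and 5/4, so the quotient is
    at least 3/5. *)
Lemma slope_bound {phi psi q} {r : R} : `|q| < r -> r ^+ 2 * `|phi q| <= 4^-1 ->
  `|psi q| <= 4^-1 ->
  2^-1 <= slope phi psi q /\
  slope phi psi q * (1 - (cx q ^+ 2 - cy q ^+ 2) * phi q) = 1 + psi q.
Proof.
move=> qr phir psi4.
have cr i : `|q ord0 i| < r by apply: le_lt_trans (coord_le_norm _ _ _) qr.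
have := denominator_bound (cr (@Ordinal 4 0 isT)) (cr (@Ordinal 4 1 isT)) phir.
move: psi4; rewrite !ler_norml => /andP[? ?] /andP[? ?].
rewrite /slope divfK; last by rewrite gt_eqF//; lra.
by split=> //; rewrite ler_pdivlMr; lra.
Qed.

(** A first radius [r1] makes [phi], [psi1], [psi2] harmless and the slope Lipschitz with some
    constant [L]. As [L] stays valid on smaller balls, the radius can then be shrunk to make [r * L]
    small. *)
Lemma exists_small_radius {M : set vec} {phi psi1 psi2} :
  open M -> M 0 -> smooth_on M phi -> smooth_on M psi1 -> smooth_on M psi2 ->
  psi1 0 = 0 -> psi2 0 = 0 ->
  exists r L : R, [/\ 0 < r <= 1, 0 <= L & r * L <= 8^-1] /\
    [/\ forall q, `|q| < r -> [/\ M q, r ^+ 2 * `|phi q| <= 4^-1,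
          `|psi1 q| <= 1 & `|psi2 q| <= 4^-1],
        forall p q, `|p| < r -> `|q| < r ->
          `|slope phi psi2 p - slope phi psi2 q| <= L * `|p - q| &
        bounded_lipschitz r (height (slope phi psi2))].
Proof.
move=> oM M0 sphi spsi1 spsi2 psi10 psi20.
have [ra ra0 lphi] := C1_bounded_lipschitz oM M0 (sphi 1%N).
have [rb rb0 lpsi] := C1_bounded_lipschitz oM M0 (spsi2 1%N).
have near_small (h : vec -> R) e : 0 < e -> smooth_on M h -> h 0 = 0 ->
    \forall q \near (0 : vec), `|h q| <= e.
  move=> e0 sh h0; have /cvgr_dist_le /(_ e e0) := (sh 0%N).1 _ M0.
  by apply: filterS => q; rewrite h0 sub0r normrN.
have : \forall q \near (0 : vec), [/\ M q, `|psi1 q| <= 1 & `|psi2 q| <= 4^-1].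
  have nM : \forall q \near (0 : vec), M q by exact: open_nbhs_nbhs.
  have n1 := near_small psi1 1 ltr01 spsi1 psi10.
  have n2 : \forall q \near (0 : vec), `|psi2 q| <= 4^-1 by apply: near_small.
  by move: nM n1 n2; apply: filterS3 => q; split.
move=> /nbhs_norm0P[rc /= rc0 rcP].
have [C C0 [phiC _]] := lphi.
(* The last entry yields [r1 * (C + 1) <= 1/4], hence both [r1 <= 1/4] and [r1 ^+ 2 * C <= 1/4],
   where [C] bounds [phi]. *)
pose r1 := Num.min (Num.min ra rb) (Num.min rc (4 * (C + 1))^-1).
have C1 : 0 < 4 * (C + 1) by lra.
have r1_gt0 : 0 < r1 by rewrite !lt_min ra0 rb0 rc0 invr_gt0 C1.
have [r1a r1b r1c r1C] :
    [/\ r1 <= ra, r1 <= rb, r1 <= rc & r1 <= (4 * (C + 1))^-1].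
  by rewrite /r1 !ge_min !lexx ?orbT.
have r1C4 : r1 * (C + 1) <= 4^-1.
  by have := ler_wpM2l (ltW C1) r1C; rewrite mulfV ?gt_eqF//; lra.
have r11 : r1 <= 4^-1 by nra.
have small1 q : `|q| < r1 -> [/\ M q, r1 ^+ 2 * `|phi q| <= 4^-1,
    `|psi1 q| <= 1 & `|psi2 q| <= 4^-1].
  move=> qr; have [Mq q1 q2] := rcP q (lt_le_trans qr r1c).
  split=> //; have := phiC q (lt_le_trans qr r1a); have := normr_ge0 (phi q).
  move=> p0 pC; rewrite expr2; apply: (@le_trans _ _ (r1 * r1 * C)).
    by rewrite ler_wpM2l// mulr_ge0// ltW.
  apply: le_trans r1C4; rewrite -mulrA ler_wpM2l ?(ltW r1_gt0)//.
  by nra.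
have lcoord i : bounded_lipschitz r1 (fun q : vec => q ord0 i).
  exact/bounded_lipschitz_coord/ltW.
have lphi1 := bounded_lipschitz_le r1a lphi.
have lpsi1 := bounded_lipschitz_le r1b lpsi.
have lslope : bounded_lipschitz r1 (slope phi psi2).
  apply: bounded_lipschitzM.
    by apply: bounded_lipschitzD => //; exact: bounded_lipschitz_cst.
  apply: (@bounded_lipschitzV _ _ _ _ (3 / 4)) => //.
    move=> q qr; have [_ pr _ _] := small1 q qr.
    have cr i : `|q ord0 i| < r1 by apply: le_lt_trans (coord_le_norm _ _ _) qr.
    have cx_r := cr (@Ordinal 4 0 isT); have cy_r := cr (@Ordinal 4 1 isT).
    have := denominator_bound cx_r cy_r pr.
    by rewrite ler_norml => /andP[? ?]; lra.
  have -> : (fun q : vec => 1 - (cx q ^+ 2 - cy q ^+ 2) * phi q) =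
      (fun q => 1 + ((-1) * (cx q * cx q) + cy q * cy q) * phi q).
    by apply/funext => q; ring.
  apply: bounded_lipschitzD; first exact: bounded_lipschitz_cst.
  apply: bounded_lipschitzM => //; apply: bounded_lipschitzD.
    apply: bounded_lipschitzM; first exact: bounded_lipschitz_cst.
    by apply: bounded_lipschitzM; exact: lcoord.
  by apply: bounded_lipschitzM; exact: lcoord.
have [L L0 [_ slopeL]] := lslope.
pose r := Num.min r1 (8 * (L + 1))^-1.
have L1 : 0 < 8 * (L + 1) by lra.
have rr1 : r <= r1 by rewrite /r ge_min lexx.
have r_gt0 : 0 < r by rewrite lt_min r1_gt0 invr_gt0.
have rL : r * (8 * (L + 1)) <= 1.
  by rewrite -ler_pdivlMr// mul1r /r ge_min lexx orbT.
have lt1 q : `|q| < r -> `|q| < r1 by move=> /lt_le_trans; apply.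
exists r, L; split; first by split; [lra|by []|lra].
split.
- move=> q qr; have [Mq pr p1 p2] := small1 q (lt1 _ qr); split=> //.
  apply: le_trans pr; rewrite ler_wpM2r// ler_sqr ?nnegrE//; exact: ltW.
- by move=> p q pr qr; apply: slopeL; exact: lt1.
- apply: bounded_lipschitz_le rr1 _; rewrite /height.
  apply: bounded_lipschitzD; first exact: lcoord.
  apply: bounded_lipschitzM; last exact: bounded_lipschitz_restrict.
  apply: bounded_lipschitzM; first exact: bounded_lipschitz_cst.
  have -> : (fun q : vec => cx q * cy q ^+ 2) = (fun q => cx q * (cy q * cy q)).
    by apply/funext => q; rewrite expr2.
  apply: bounded_lipschitzM; first exact: lcoord.
  by apply: bounded_lipschitzM; exact: lcoord.
Qed.

(** * Monotonicity of the height along causal curves *)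

(** At almost every time [height_derivative_bound] supplies the inequality required by
    [near_height_increment]; [abs_continuous_le] integrates the result. *)
Lemma height_le_causal {M H g X Y phi psi1 psi2} {r L T : R} {c} :
  lorentzian_metric M H g -> orthonormal_frame M H g X Y ->
  normal_form_frame M phi psi1 psi2 X Y ->
  r <= 1 -> 0 <= L -> r * L <= 8^-1 ->
  (forall q, `|q| < r -> [/\ M q, r ^+ 2 * `|phi q| <= 4^-1,
     `|psi1 q| <= 1 & `|psi2 q| <= 4^-1]) ->
  (forall p q, `|p| < r -> `|q| < r ->
     `|slope phi psi2 p - slope phi psi2 q| <= L * `|p - q|) ->
  bounded_lipschitz r (height (slope phi psi2)) ->
  0 <= T -> nonspacelike_fd_curve M H g X 0 T c ->
  (forall t, t \in `[0, T] -> `|c t| < r) ->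
  height (slope phi psi2) (c 0) <= height (slope phi psi2) (c T).
Proof.
move=> lor fr nf r1 L0 rL box slopeL lheight T0 [[_ acc aeH] aefd] cr.
pose f := slope phi psi2.
apply: (@abs_continuous_le _ 0 T (height f \o c)) => //.
  exact: abs_continuous_comp acc cr.
apply: ae_on_impl2 aeH aefd => t tT [dc _] [ns fd] e e0; have ctr := cr t tT.
apply: (near_height_increment dc ctr e0 L0) => //=.
  move=> p q pr qr; rewrite /restrict_y0.
  apply: le_trans (slopeL _ _ _ _) _; [exact: restrict_norm_lt..|].
  by apply: ler_wpM2l => //; exact: restrict_norm_le.
set q := c t; set v := derive1 c t.
have [Mq phir p1 p2] := box q ctr.
have qr i : `|q ord0 i| < r by apply: le_lt_trans (coord_le_norm _ _ _) ctr.
have qx := qr (@Ordinal 4 0 isT); have qy := qr (@Ordinal 4 1 isT).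
have [a [b [vE ba]]] := future_nonspacelike_coord lor fr Mq ns fd.
have [[X0 X1 X2 X3] [Y0 Y1 Y2 Y3]] := frame_coord nf Mq.
have vxE : cx v = a * (1 + cy q ^+ 2 * phi q) - b * (cx q * cy q * phi q).
  by rewrite /v vE !mxE X0 Y0; ring.
have vyE : cy v = a * (cx q * cy q * phi q) + b * (1 - cx q ^+ 2 * phi q).
  by rewrite /v vE !mxE X1 Y1; ring.
have vzE : cz v = 2^-1 * (1 + psi1 q) * (cy q * a - cx q * b).
  by rewrite /v vE !mxE X2 Y2; ring.
have vwE : cw v = 2^-1 * cy q * (1 + psi2 q) * (cy q * a - cx q * b).
  by rewrite /v vE !mxE X3 Y3; ring.
have [f2 fE] := slope_bound ctr phir p2.
have q'r := restrict_norm_lt ctr; have [_ phir' _ p2'] := box _ q'r.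
have [f2' _] := slope_bound q'r phir' p2'.
have a0 : 0 <= a := le_trans (normr_ge0 _) ba.
(* The Lipschitz estimate of f0 involves the sup norm of the whole velocity, so the [z] and [w]
   components are bounded too. *)
have v2a : `|v| <= 2 * a.
  have [h0 h1] := horizontal_speed_bound qx qy phir ba.
  have [h2 _] := vertical_speed_bound qx qy r1 ba p1.
  have p21 : `|psi2 q| <= 1 by lra.
  have [_ h3] := vertical_speed_bound qx qy r1 ba p21.
  apply: norm_row_le; first by rewrite mulr_ge0.
  by apply: forall_ord4; rewrite ?vxE ?vyE ?vzE ?vwE.
have ff0 : `|f q - restrict_y0 f q| <= L * `|cy q|.
  rewrite /restrict_y0; apply: le_trans (slopeL _ _ ctr q'r) _.
  by apply: ler_wpM2l => //; exact: dist_restrict.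
apply: le_trans (height_derivative_bound qx qy phir ba fE vxE vyE vwE
  f2 f2' ff0 L0 rL).
by apply: ler_wpM2l => //; rewrite mulr_ge0.
Qed.

(** * Coordinates and affine curves *)

Lemma ptE (x y z w : R) :
  pt x y z w = x *: d_x + y *: d_y + z *: d_z + w *: d_w :> vec.
Proof. by apply/rowP; apply: forall_ord4; rewrite !mxE/=; ring. Qed.

Lemma pairingE p q :
  pairing p q = cx p * cx q + cy p * cy q + cz p * cz q + cw p * cw q.
Proof.
rewrite /pairing !big_ord_recl big_ord0 addr0 !addrA.
by congr (_ * _ + _ * _ + _ * _ + _ * _); congr (_ ord0 _); exact: val_inj.
Qed.

Lemma is_derive_affine {W : normedModType R} (v w : W) (t : R) :
  is_derive t 1 (fun s : R => s *: v + w) v.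
Proof.
have lim : h^-1 *: ((h *: 1 + t) *: v + w - (t *: v + w)) @[h --> 0^'] --> v.
  apply: cvg_near_cst; near=> h.
  have h0 : h != 0 by near: h; exact: nbhs_dnbhs_neq.
  rewrite opprD addrACA subrr addr0 -scalerBl addrK scalerA [h *: 1]mulr1.
  by rewrite mulVf// scale1r.
by split; [exact: cvgP lim|exact: cvg_lim lim].
Unshelve. all: by end_near.
Qed.

Lemma abs_continuous_affine {W : normedModType R} (v w : W) (a b : R) :
  abs_continuous a b (fun s : R => s *: v + w).
Proof.
move=> e e0; have v0 : 0 < `|v| + 1 by rewrite ltr_wpDl.
exists (e / (`|v| + 1)); first by rewrite divr_gt0.
move=> m u u' uu' _; rewrite ltr_pdivlMr// => lte.
apply: le_lt_trans lte; rewrite mulr_suml; apply: ler_sum => i _.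
have [_ [le_uu' _]] := uu' i.
rewrite opprD addrACA subrr addr0 -scalerBl normrZ ger0_norm ?subr_ge0//.
by rewrite ler_wpM2l ?subr_ge0// lerDl.
Qed.

(** * The line [gamma] as a timelike and abnormal curve *)

Section abnormal_line.
Context {M : set vec} {H : vec -> {vspace vec}} {g : vec -> vec -> vec -> R}.
Context {X Y : vec -> vec} {phi psi1 psi2 : vec -> R}.
Context (frameXY : orthonormal_frame M H g X Y)
  (normalXY : normal_form_frame M phi psi1 psi2 X Y)
  (cphi : forall q, M q -> {for q, continuous phi})
  (cpsi1 : forall q, M q -> {for q, continuous psi1})
  (cpsi2 : forall q, M q -> {for q, continuous psi2}).

Let gamma (t : R) : vec := pt t 0 0 0.

Let gammaE : gamma = fun t => t *: d_x + 0.
Proof.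
by apply/funext => t; rewrite /gamma ptE !scale0r !addr0.
Qed.

Lemma frame_line {t} : M (gamma t) -> X (gamma t) = d_x.
Proof.
move=> Mt; have [[h0 h1 h2 h3] _] := frame_coord normalXY Mt.
apply/rowP; apply: forall_ord4; rewrite ?h0 ?h1 ?h2 ?h3 !mxE/=; ring.
Qed.

Lemma velocity_line {t} : M (gamma t) ->
  derivable gamma t 1 /\ derive1 gamma t = X (gamma t).
Proof.
move=> Mt; have [dg dgE] := is_derive_affine (d_x : vec) 0 t.
by rewrite (frame_line Mt) gammaE derive1E; split.
Qed.

Lemma horizontal_line {a b : R} : (forall t, t \in `[a, b] -> M (gamma t)) ->
  horizontal M H a b gamma.
Proof.
move=> Mg; split=> //; first by rewrite gammaE; exact: abs_continuous_affine.
apply: ae_onW => t tab; have Mt := Mg t tab.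
have [_ _ /(_ _ Mt)[HE _ _ _]] := frameXY.
by have [dg ->] := velocity_line Mt; rewrite HE memv_span// !inE eqxx.
Qed.

Lemma timelike_line {a b : R} : (forall t, t \in `[a, b] -> M (gamma t)) ->
  timelike_fd_curve M H g X a b gamma.
Proof.
move=> Mg; split; first exact: horizontal_line.
apply: ae_onW => t tab; have Mt := Mg t tab.
have [_ _ /(_ _ Mt)[HE gXX _ _]] := frameXY.
have [_ ->] := velocity_line Mt.
rewrite /timelike /future_directed gXX ltrN10; split=> //; split=> //.
by rewrite HE memv_span// !inE eqxx.
Qed.

Lemma nonspacelike_line {a b : R} : (forall t, t \in `[a, b] -> M (gamma t)) ->
  nonspacelike_fd_curve M H g X a b gamma.
Proof.
move=> Mg; have [hor ae] := timelike_line Mg; split=> //.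
apply: (ae_on_impl2 _ ae ae) => t tab [[vH v0] fd] _.
split=> //; split=> //; first exact: ltW.
apply/eqP => vE; have Mt := Mg t tab.
have [_ dgE] := velocity_line Mt.
move: vE; rewrite dgE frame_line// => /rowP/(_ (@Ordinal 4 0 isT)).
by rewrite !mxE/=; lra.
Qed.

(* The biextremal is constant in the fibre: it is dw along gamma. *)
Let lift (t : R) : vec * vec := t *: (d_x, 0) + (0, d_w).

Let liftE t : lift t = (gamma t, d_w).
Proof. by rewrite gammaE /lift; congr (_, _); rewrite /= ?scaler0 ?add0r. Qed.

(* The equation <p, X> = 0, solved for p_x: the right-hand side is a product of
   two functions which vanish on the line y = 0, p = dw. *)
Lemma annihilator_coord (l : vec * vec) : annihilator M H l ->
  let x := cx l.1 in let y := cy l.1 in let p := l.2 in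
  cx p = - (y * (cx p * (y * phi l.1) + cy p * (x * phi l.1) +
                 cz p * (2^-1 * (1 + psi1 l.1)) +
                 cw p * (2^-1 * y * (1 + psi2 l.1)))).
Proof.
move=> [Ml lH] x y p; have [_ _ /(_ _ Ml)[HE _ _ _]] := frameXY.
have /lH : X l.1 \in H l.1 by rewrite HE memv_span// !inE eqxx.
have [[h0 h1 h2 h3] _] := frame_coord normalXY Ml.
rewrite pairingE h0 h1 h2 h3 -/x -/y -/p => E.
by apply/eqP; rewrite -subr_eq0 -E; apply/eqP; ring.
Qed.

(** The [w] components of [X] and [Y] carry a factor [y], so [dw] vanishes on [H] along the line. *)
Lemma annihilator_line {t} : M (gamma t) -> annihilator M H (lift t).
Proof.
move=> Mt; rewrite liftE; split=> //= v /(in_frame_span frameXY Mt)[a [b ->]].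
have [[_ _ _ h] [_ _ _ h']] := frame_coord normalXY Mt.
by rewrite pairingE !mxE h h' !mxE/=; ring.
Qed.

(** Along a curve in the annihilator, [annihilator_coord] gives [p_x = - y B]. At the base point
    [y = 0], so the difference quotient of [p_x] is minus that of [y] times [B], and [B] tends to
    0. *)
Lemma tangent_annihilator_line {t zeta} : M (gamma t) ->
  tangent_at (annihilator M H) (lift t) zeta -> cx zeta.2 = 0.
Proof.
move=> Mt [e [c [[e0 sc cH] [c0 dcE]]]].
have I0 : `]- e, e[%classic (0 : R).
  by rewrite /= in_itv/=; apply/andP; split; lra.
have [dc _] := (sc 1%N).2 1; have dc0 := dc 0 I0.
have lim : h^-1 *: (c h - c 0) @[h --> 0^'] --> zeta.
  have -> : (fun h => h^-1 *: (c h - c 0)) =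
      (fun h => h^-1 *: (c (h *: 1 + 0) - c 0)).
    by apply/funext => h; rewrite addr0 [h *: 1]mulr1.
  by rewrite -dcE derive1E; exact: dc0.
have cc : {for 0, continuous c} := (sc 0%N).1 0 I0.
have cfst : (fun s => (c s).1) @ 0 --> gamma t.
  have -> : gamma t = (c 0).1 by rewrite c0 liftE.
  exact: (cvg_comp _ _ cc cvg_fst).
have csnd : (fun s => (c s).2) @ 0 --> (d_w : vec).
  have -> : d_w = (c 0).2 by rewrite c0 liftE.
  exact: (cvg_comp _ _ cc cvg_snd).
have coord i (q : vec) (k : R -> vec) (F : set_system R) : Filter F ->
    k @ F --> q -> (fun s => k s ord0 i) @ F --> q ord0 i.
  by move=> FF kq; apply: (cvg_comp _ _ kq (@coord_continuous R 1 4 ord0 i q)).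
have cfsti i : (fun s => (c s).1 ord0 i) @ 0 --> gamma t ord0 i.
  exact: (coord i _ (fun s => (c s).1)).
have csndi i : (fun s => (c s).2 ord0 i) @ 0 --> (d_w : vec) ord0 i.
  exact: (coord i _ (fun s => (c s).2)).
pose B s := cx (c s).2 * (cy (c s).1 * phi (c s).1) +
  cy (c s).2 * (cx (c s).1 * phi (c s).1) +
  cz (c s).2 * (2^-1 * (1 + psi1 (c s).1)) +
  cw (c s).2 * (2^-1 * cy (c s).1 * (1 + psi2 (c s).1)).
(* At [dw] only the last summand of [B] can survive, and it carries a factor [y]. *)
have B0 : B @ 0 --> (0 : R).
  have cphi0 := cvg_comp _ _ cfst (cphi _ Mt).
  have cpsi10 := cvg_comp _ _ cfst (cpsi1 _ Mt).
  have cpsi20 := cvg_comp _ _ cfst (cpsi2 _ Mt).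
  pose l := cx d_w * (cy (gamma t) * phi (gamma t)) +
    cy d_w * (cx (gamma t) * phi (gamma t)) +
    cz d_w * (2^-1 * (1 + psi1 (gamma t))) +
    cw d_w * (2^-1 * cy (gamma t) * (1 + psi2 (gamma t))).
  suff : B @ 0 --> l by rewrite (_ : l = 0)// /l !mxE/=; ring.
  apply: cvgD; first apply: cvgD; first apply: cvgD.
  - apply: cvgM; first exact: csndi.
    by apply: cvgM; [exact: cfsti|exact: cphi0].
  - apply: cvgM; first exact: csndi.
    by apply: cvgM; [exact: cfsti|exact: cphi0].
  - apply: cvgM; first exact: csndi.
    apply: cvgM; first exact: cvg_cst.
    by apply: cvgD; [exact: cvg_cst|exact: cpsi10].
  - apply: cvgM; first exact: csndi.
    apply: cvgM; last by apply: cvgD; [exact: cvg_cst|exact: cpsi20].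
    by apply: cvgM; [exact: cvg_cst|exact: cfsti].
have lim1 : cx (h^-1 *: (c h - c 0)).2 @[h --> 0^'] --> cx zeta.2.
  apply: (coord _ _ (fun h => (h^-1 *: (c h - c 0)).2)).
  exact: (cvg_comp _ _ lim cvg_snd).
have lim2 : cy (h^-1 *: (c h - c 0)).1 @[h --> 0^'] --> cy zeta.1.
  apply: (coord _ _ (fun h => (h^-1 *: (c h - c 0)).1)).
  exact: (cvg_comp _ _ lim cvg_fst).
have lim3 : - (cy (h^-1 *: (c h - c 0)).1 * B h) @[h --> 0^'] --> (0 : R).
  rewrite -[X in _ --> X]oppr0 -[X in _ --> - X](mulr0 (cy zeta.1)).
  by apply: cvgN; apply: (cvgM lim2); apply: cvg_within_filter; exact: B0.
suff lim4 : cx (h^-1 *: (c h - c 0)).2 @[h --> 0^'] --> (0 : R).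
  by rewrite -(cvg_lim (@norm_hausdorff _ R) lim1); apply: cvg_lim lim4.
apply: cvg_trans lim3; apply: near_eq_cvg; near=> h.
have hI : `]- e, e[%classic h.
  rewrite /= in_itv/=; apply/andP; split; near: h; apply: nbhs_dnbhs;
    [apply: lt_nbhsr|apply: lt_nbhsl]; lra.
have /= := annihilator_coord _ (cH h hI); rewrite -/(B h) => chE.
rewrite c0 liftE !mxE/= chE; ring.
Unshelve. all: by end_near.
Qed.

(** The lift has velocity [(d_x, 0)], whose symplectic product with [zeta] is minus the [x]
    coordinate of [zeta.2]; this is 0 for tangent [zeta]. *)
Lemma abnormal_line {T : R} : (forall t, t \in `[0, T] -> M (gamma t)) ->
  abnormal_curve M H 0 T gamma.
Proof.
move=> Mg; split; first exact: horizontal_line.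
exists lift; split; last by move=> t _; rewrite liftE.
split; first exact: abs_continuous_affine.
- move=> t /Mg/annihilator_line; split=> //; rewrite liftE/=.
  apply/eqP => /rowP/(_ (@Ordinal 4 3 isT)); rewrite !mxE/=; lra.
- apply: ae_onW => t /Mg Mt.
  have [dl dlE] := is_derive_affine ((d_x, 0) : vec * vec) (0, d_w) t.
  split=> // zeta /(tangent_annihilator_line Mt) zx.
  rewrite derive1E dlE /symplectic_form !pairingE/= zx !mxE/=; ring.
Qed.

End abnormal_line.

End height.

(** * Geometric optimality of the abnormal line *)

Theorem proposition1p2 (R : realType) (M : set 'rV[R]_4)
    (H : 'rV[R]_4 -> {vspace 'rV[R]_4})
    (g : 'rV[R]_4 -> 'rV[R]_4 -> 'rV[R]_4 -> R)
    (X Y : 'rV[R]_4 -> 'rV[R]_4) (phi psi1 psi2 : 'rV[R]_4 -> R)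
    (M_open : open M) (M0 : M 0)
    (frameXY : orthonormal_frame M H g X Y)
    (orientX : time_orientation M H g X)
    (hamiltonianH : engel_hamiltonian_type M H g X Y X)
    (normalXY : normal_form_frame M phi psi1 psi2 X Y)
    (smooth_phi : smooth_on M phi)
    (smooth_psi1 : smooth_on M psi1)
    (smooth_psi2 : smooth_on M psi2)
    (psi1_0 : forall z w, M (pt 0 0 z w) -> psi1 (pt 0 0 z w) = 0)
    (psi2_0 : forall w, M (pt 0 0 0 w) -> psi2 (pt 0 0 0 w) = 0)
    (phi_z : independent_of_z M phi)
    (psi2_z : independent_of_z M psi2) :
  let gamma := fun t : R => pt t 0 0 0 in
  exists2 W : set 'rV[R]_4, nbhs (0 : 'rV[R]_4) W &
    forall U : set 'rV[R]_4,
      normal_neighbourhood M H g 0 U -> U `<=` W ->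
      forall T : R, 0 < T -> (forall t, t \in `[0, T] -> U (gamma t)) ->
        [/\ abnormal_curve M H 0 T gamma,
            timelike_fd_curve M H g X 0 T gamma &
            geometrically_optimal M H g X U T gamma].
Proof.
move=> gamma.
have gamma0 : gamma 0 = 0 by rewrite /gamma ptE !scale0r !addr0.
have [[_ _ lor] _ _] := hamiltonianH.
have psi10 : psi1 0 = 0 by rewrite -gamma0 psi1_0// -/(gamma 0) gamma0.
have psi20 : psi2 0 = 0 by rewrite -gamma0 psi2_0// -/(gamma 0) gamma0.
have [r [L [[/andP[r0 r1] L0 rL] [box slopeL lheight]]]] :=
  exists_small_radius M_open M0 smooth_phi smooth_psi1 smooth_psi2 psi10 psi20.
(* Causal curves contained in [U] then stay in the ball where the height is monotone. *)
exists [set q | `|q| < r]; first exact: (@nbhs0_lt R 'rV[R]_4 r r0).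
move=> U [V [h [U' [_ [[oU _ _ _] _ _]]]]] UW T T0 Ug.
have Mg t : t \in `[0, T] -> M (gamma t) by move=> /Ug/UW/= /box[].
have csmooth (f : 'rV[R]_4 -> R) :
    smooth_on M f -> forall q, M q -> {for q, continuous f}.
  by move=> sf q Mq; exact: (sf 0%N).1.
split.
- exact: (abnormal_line frameXY normalXY (csmooth _ smooth_phi)
    (csmooth _ smooth_psi1) (csmooth _ smooth_psi2) Mg).
- exact: (timelike_line frameXY normalXY Mg).
split=> //; first exact: (nonspacelike_line frameXY normalXY Mg).
move=> t t0T; have Ut := Ug t t0T.
have [t0 tT] : 0 <= t /\ t <= T.
  by move: t0T; rewrite in_itv/= => /andP[].
have sub s : s \in `[0, t] -> s \in `[0, T].
  by rewrite !in_itv/= => /andP[-> /le_trans]; exact.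
split; first split=> //.
  (* [gamma t] is itself in the causal future, reached by [gamma] stopped at time [t]. *)
  apply: subset_closure; split=> //; exists t, gamma; split=> //.
    by apply: (nonspacelike_line frameXY normalXY) => s /sub/Mg.
  by move=> s /sub/Ug.
move=> B Bt.
(* Every neighbourhood of [gamma t] must meet [U] outside the causal future: the points sought lie
   on the line leaving [gamma t] in the direction of decreasing [w]. *)
pose l (s : R) := s *: (- d_w) + gamma t.
have cl : l @ 0 --> l 0.
  have [dl _] := is_derive_affine (- d_w : 'rV[R]_4) (gamma t) 0.
  exact: (differentiable_continuous ((derivable1_diffP _ _).1 dl)).
have l0 : l 0 = gamma t by rewrite /l scale0r add0r.
have UBt : nbhs (gamma t) (U `&` B).
  by apply: filterI => //; exact: open_nbhs_nbhs.
have /nbhs_ballP[e /= e0 eUB] : nbhs 0 (l @^-1` (U `&` B)).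
  by apply: cl; rewrite l0.
have [] := eUB (e / 2); first by rewrite /ball/= sub0r normrN gtr0_norm; lra.
have -> : l (e / 2) = pt t 0 0 (- (e / 2)).
  by rewrite /l /gamma !ptE !scale0r !addr0 scalerN scaleNr addrC.
move=> Uq Bq; exists (pt t 0 0 (- (e / 2))); split=> //; split=> //.
move=> [S [c [S0 nsc cU c0 cS]]].
(* The height is 0 at the origin and [- (e / 2)] at the end of [c], as the correction term vanishes
   for [y = 0]: a contradiction. *)
have := height_le_causal lor frameXY normalXY r1 L0 rL box slopeL lheight S0 nsc
  (fun s hs => UW _ (cU s hs)).
by rewrite c0 cS /height !mxE/=; lra.
Qed.
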